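(* (i) Let $\{R_x\}_{x\in X}$ be a family of commutative rings satisfying $\Delta_{\mathrm{SL}}$ and let $R=\prod_x R_x$. Then $R$ satisfies $\Delta_{\mathrm{SL}}$. (ii) Let $R$ be a commutative ring which satisfies $\Delta_{\mathrm{SL}}$. Let $\overline R$ be a quotient ring of $R$ such that the natural map $\mathrm{SL}_n(R)\to\mathrm{SL}_n(\overline R)$ is surjective for every $n$. Then $\overline R$ satisfies $\Delta_{\mathrm{SL}}$.
   Context: All rings are commutative with identity. For a finitely generated $R$-module $M$, $\mu(M)$ is the minimal number of generators of $M$; for $n\ge\mu(M)$, $V_n(M)\subseteq M^n$ is the set of $n$-tuples whose components generate $M$. The group $\mathrm{SL}_n(R)$ of $n\times n$ matrices of determinant $1$ acts on $V_n(M)$ by matrix right-multiplication. The determinant map is $M^n\to\bigwedge^n M$, $(m_1,\dots,m_n)\mapsto m_1\wedge\cdots\wedge m_n$. A finitely generated $R$-module $M$ satisfies the property $\Delta_{\mathrm{SL}}$ if the determinant map induces a bijection from $V_n(M)/\mathrm{SL}_n(R)$ to $V_1(\bigwedge^n M)$ for every $n\ge\mu(M)$, $n\geq 1$ (here $V_1(N)$ is the set of single generators of $N$; in particular $V_1(0)=\{0\}$). The ring $R$ satisfies $\Delta_{\mathrm{SL}}$ if every finitely presented $R$-module satisfies $\Delta_{\mathrm{SL}}$. *)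

(* Defs.v *)
From HB Require Import structures.
From mathcomp Require Import all_boot all_algebra.
From mathcomp Require Import boolp classical_sets functions cardinality.

Set Implicit Arguments.
Unset Strict Implicit.
Unset Printing Implicit Defensive.

Import GRing.Theory.

Local Open Scope classical_set_scope.
Local Open Scope ring_scope.

(* Rings are [comPzRingType]: the zero ring is a commutative ring with
   identity, and it does occur (empty products, improper quotients).

   The ring structure of [functions] on [T -> R] does not cover families of
   distinct rings, and instances on the bare dependent product would clash with
   it, hence the alias. *)
Definition prod_ring (X : Type) (R : X -> comPzRingType) : Type :=
  forall x, R x.

Section ProdRing.
Variables (X : Type) (R : X -> comPzRingType).
Local Notation P := (prod_ring R).
Implicit Types f g h : P.

HB.instance Definition _ :=
  Choice.copy P (forall x, (R x : choiceType)).

Let zero : P := fun=> 0.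
Let one : P := fun=> 1.
Let opp f : P := fun x => - f x.
Let add f g : P := fun x => f x + g x.
Let mul f g : P := fun x => f x * g x.

Let addA : associative add.
Proof. by move=> f g h; apply: functional_extensionality_dep => x; exact: addrA. Qed.
Let addC : commutative add.
Proof. by move=> f g; apply: functional_extensionality_dep => x; exact: addrC. Qed.
Let add0 : left_id zero add.
Proof. by move=> f; apply: functional_extensionality_dep => x; exact: add0r. Qed.
Let addN : left_inverse zero opp add.
Proof. by move=> f; apply: functional_extensionality_dep => x; exact: addNr. Qed.
Let mulA : associative mul.
Proof. by move=> f g h; apply: functional_extensionality_dep => x; exact: mulrA. Qed.
Let mulC : commutative mul.
Proof. by move=> f g; apply: functional_extensionality_dep => x; exact: mulrC. Qed.
Let mul1 : left_id one mul.
Proof. by move=> f; apply: functional_extensionality_dep => x; exact: mul1r. Qed.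
Let mulDl : left_distributive mul add.
Proof. by move=> f g h; apply: functional_extensionality_dep => x; exact: mulrDl. Qed.

HB.instance Definition _ := GRing.isZmodule.Build P addA addC add0 addN.
HB.instance Definition _ :=
  GRing.Zmodule_isComPzRing.Build P mulA mulC mul1 mulDl.
End ProdRing.

(* The submodule generated by [A]. *)
Definition span_pred (R : pzRingType) (V : lmodType R) (A : set V) : {pred V} :=
  fun v => `[< exists s : seq (R * V),
    (forall p, p \in s -> A p.2) /\ v = \sum_(p <- s) p.1 *: p.2 >].

Section Span.
Variables (R : pzRingType) (V : lmodType R) (A : set V).

Lemma span_predP v :
  reflect (exists s : seq (R * V),
    (forall p, p \in s -> A p.2) /\ v = \sum_(p <- s) p.1 *: p.2)
    (v \in span_pred A).
Proof. exact: asboolP. Qed.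

Let span_subsemimod : GRing.subsemimod_closed (span_pred A).
Proof.
split=> [|a v /span_predP[s [sA ->]]]; last first.
  apply/span_predP; exists [seq (a * p.1, p.2) | p <- s].
  split=> [p /mapP[q qs ->] /=|]; first exact: sA.
  by rewrite big_map scaler_sumr; apply: eq_bigr => p _; rewrite scalerA.
split=> [|v w /span_predP[s [sA ->]] /span_predP[t [tA ->]]].
  by apply/span_predP; exists [::]; rewrite big_nil.
apply/span_predP; exists (s ++ t); rewrite big_cat; split=> // p.
by rewrite mem_cat => /orP[/sA|/tA].
Qed.

HB.instance Definition _ := GRing.isSubmodClosed.Build R V (span_pred A)
  span_subsemimod.

Lemma span_predZ a v : v \in span_pred A -> a *: v \in span_pred A.
Proof. exact: (span_subsemimod.2 a v). Qed.
End Span.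

(* The quotient of [V] by the submodule generated by [A]; [Quotient.quot] only
   carries an additive group structure. *)
Definition quotmod (R : pzRingType) (V : lmodType R) (A : set V) : Type :=
  Quotient.quot (span_pred A).

Section QuotientModule.
Variables (R : pzRingType) (V : lmodType R) (A : set V).
Local Notation Q := (quotmod A).

HB.instance Definition _ := GRing.Zmodule.copy Q (Quotient.quot (span_pred A)).

Definition quotmod_pi (v : V) : Q := \pi_(Quotient.quot (span_pred A))%qT v.

Lemma quotmod_eqP v w :
  reflect (quotmod_pi v = quotmod_pi w) (v - w \in span_pred A).
Proof. by rewrite Quotient.idealrBE; exact: eqP. Qed.

Lemma quotmod_pi_repr (q : Q) :
  quotmod_pi (repr (q : Quotient.quot (span_pred A))) = q.
Proof. exact: reprK. Qed.

Let pi_zmod_morphism : zmod_morphism quotmod_pi.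
Proof. by move=> v w; exact: (raddfB (\pi_(Quotient.quot (span_pred A))%qT)). Qed.

HB.instance Definition _ :=
  GRing.isZmodMorphism.Build V Q quotmod_pi pi_zmod_morphism.

Let scale (a : R) (q : Q) : Q :=
  quotmod_pi (a *: repr (q : Quotient.quot (span_pred A))).

Let pi_scale a v : quotmod_pi (a *: v) = scale a (quotmod_pi v).
Proof.
apply/quotmod_eqP; rewrite -scalerBr; apply: span_predZ.
by apply/quotmod_eqP; rewrite quotmod_pi_repr.
Qed.

Let scaleA a b q : scale a (scale b q) = scale (a * b) q.
Proof. by rewrite -(quotmod_pi_repr q) -!pi_scale scalerA. Qed.
Let scale1 : left_id 1 scale.
Proof. by move=> q; rewrite -(quotmod_pi_repr q) -pi_scale scale1r. Qed.
Let scaleDr : right_distributive scale +%R.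
Proof.
move=> a q r; rewrite -(quotmod_pi_repr q) -(quotmod_pi_repr r).
by rewrite -raddfD -!pi_scale scalerDr raddfD.
Qed.
Let scaleDl q : {morph scale^~ q : a b / a + b}.
Proof.
by move=> a b; rewrite -(quotmod_pi_repr q) -!pi_scale scalerDl raddfD.
Qed.

HB.instance Definition _ :=
  GRing.Zmodule_isLmodule.Build R Q scaleA scale1 scaleDr scaleDl.

HB.instance Definition _ := GRing.isScalable.Build R V Q *:%R quotmod_pi pi_scale.
End QuotientModule.

(* The free module on [T]: the finitely supported functions from [T] to [R]. *)
Section FreeModule.
Variables (R : pzRingType) (T : choiceType).

Definition fin_support : {pred T -> R^o} :=
  fun f => `[< finite_set [set t | f t != 0] >].

Let fin_support_subsemimod : GRing.subsemimod_closed fin_support.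
Proof.
split=> [|a f /asboolP fF]; last first.
  apply/asboolP; apply: sub_finite_set fF => t /=; apply: contra_neq => ft0.
  by rewrite /GRing.scale/= ft0 scaler0.
split=> [|f g /asboolP fF /asboolP gF]; apply/asboolP.
  suff -> : [set t | (0 : T -> R^o) t != 0] = set0 by exact: finite_set0.
  by apply/seteqP; split=> t //=; rewrite eqxx.
have := conj fF gF; rewrite -finite_setU; apply: sub_finite_set => t /=.
rewrite /GRing.add/=; case: (eqVneq (f t) 0) => [->|]; last by left.
by rewrite add0r; right.
Qed.

HB.instance Definition _ :=
  GRing.isSubmodClosed.Build R (T -> R^o) fin_support fin_support_subsemimod.

Record freemod := FreeMod {
  freemod_val :> T -> R^o; freemod_valP : freemod_val \in fin_support }.

HB.instance Definition _ := [isSub for freemod_val].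
HB.instance Definition _ := [Choice of freemod by <:].
HB.instance Definition _ := [SubChoice_isSubLmodule of freemod by <:].

Let basis_subproof (t : T) :
  (fun u => (u == t)%:R : R^o) \in fin_support.
Proof.
apply/asboolP; apply: sub_finite_set (finite_set1 t) => u /=.
by case: (eqVneq u t) => //= _; rewrite mulr0n eqxx.
Qed.

Definition freemod_basis (t : T) : freemod := FreeMod (basis_subproof t).
End FreeModule.

Section ExteriorPower.
Variables (R : comPzRingType) (M : lmodType R) (n : nat).

(* [m] with its [i]-th component replaced by [x] *)
Definition set_comp (m : 'rV[M]_n) (i : 'I_n) (x : M) : 'rV[M]_n :=
  \row_j if j == i then x else m 0 j.

Local Notation e := (@freemod_basis R 'rV[M]_n).

Definition multilinear_rels : set (freemod R 'rV[M]_n) :=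
  [set r | exists (m : 'rV[M]_n) (i : 'I_n) (a : R) (x y : M),
     r = e (set_comp m i (a *: x + y))
         - (a *: e (set_comp m i x) + e (set_comp m i y))].

Definition alternating_rels : set (freemod R 'rV[M]_n) :=
  [set r | exists (m : 'rV[M]_n) (i j : 'I_n),
     [/\ i != j, m 0 i = m 0 j & r = e m]].

Definition extpow : Type := quotmod (multilinear_rels `|` alternating_rels).
HB.instance Definition _ :=
  GRing.Lmodule.copy extpow (quotmod (multilinear_rels `|` alternating_rels)).

(* m_1 /\ ... /\ m_n *)
Definition wedge (m : 'rV[M]_n) : extpow := quotmod_pi _ (e m).
End ExteriorPower.

Section Generators.
Variables (R : comPzRingType) (M : lmodType R).

Definition lincomb n (c : 'rV[R]_n) (m : 'rV[M]_n) : M :=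
  \sum_j c 0 j *: m 0 j.

(* V_n(M) *)
Definition gen_tuples n : set 'rV[M]_n :=
  [set m | forall x : M, exists c : 'rV[R]_n, x = lincomb c m].
#[local] Arguments gen_tuples n _ : clear implicits.

(* V_1(M), with M^1 identified with M *)
Definition single_gens : set M := [set x | gen_tuples 1 (\row_(_ < 1) x)].

Definition finitely_generated : Prop := exists n, gen_tuples n !=set0.

(* The minimal number of generators; the default value 0 is only reached when
   M is not finitely generated. *)
Definition mu : nat :=
  xget 0%N [set k | gen_tuples k !=set0 /\
                    forall l, gen_tuples l !=set0 -> (k <= l)%N].

(* M is the cokernel of some P : R^k -> R^n, acting on row vectors. *)
Definition finitely_presented : Prop :=
  exists (n k : nat) (m : 'rV[M]_n) (P : 'M[R]_(k, n)),
    gen_tuples n m /\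
    forall c : 'rV[R]_n, lincomb c m = 0 <-> exists d : 'rV[R]_k, c = d *m P.
End Generators.
Arguments gen_tuples {R} M n _.
Arguments single_gens {R} M _.

Definition SL (n : nat) (R : comPzRingType) : set 'M[R]_n :=
  [set A | \det A = 1].
Arguments SL n R _ : clear implicits.

Section DeltaSL.
Variables (R : comPzRingType) (M : lmodType R).

Definition tuple_act n (m : 'rV[M]_n) (A : 'M[R]_n) : 'rV[M]_n :=
  \row_j \sum_i A i j *: m 0 i.

Definition SL_orbit n (m : 'rV[M]_n) : set 'rV[M]_n :=
  [set tuple_act m A | A in SL n R].

(* V_n(M) / SL_n(R) *)
Definition gen_orbits n : set (set 'rV[M]_n) :=
  [set SL_orbit m | m in gen_tuples M n].
#[local] Arguments gen_orbits n _ : clear implicits.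

Definition Delta_SL_module : Prop :=
  finitely_generated M /\
  forall n, (1 <= n)%N -> (mu M <= n)%N ->
    exists phi : set 'rV[M]_n -> extpow M n,
      (forall m, gen_tuples M n m -> phi (SL_orbit m) = wedge m) /\
      set_bij (gen_orbits n) (single_gens (extpow M n)) phi.
End DeltaSL.
Arguments gen_orbits {R} M n _.

Definition Delta_SL (R : comPzRingType) : Prop :=
  forall M : lmodType R, finitely_presented M -> Delta_SL_module M.

(* Main.v *)
(* Fix n generators of M whose relation module is generated by the rows of a
   matrix G, and let I be the ideal generated by the entries of G. The wedge of
   the generators generates the n-th exterior power of M with annihilator I,
   and the tuple with coordinate matrix B has wedge det B times that of the
   generators. So Delta_SL for n-tuples in M is a statement on matrices over R
   modulo the row space of G and modulo I.

   (i) Over a product of rings the matrix statement holds as soon as it holds in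
   each factor, because membership in the row space of G or in I is witnessed by
   a matrix of fixed size.

   (ii) A presentation matrix over the quotient ring lifts to R. A given
   congruence becomes one over R after adding to the lift rows that vanish in
   the quotient; Delta_SL of R then applies, and its conclusion is pushed
   forward. *)
Require Import Defs.
From HB Require Import structures.
From mathcomp Require Import all_boot all_algebra perm.
From mathcomp Require Import boolp classical_sets functions cardinality fsbigop.

Set Implicit Arguments.
Unset Strict Implicit.
Unset Printing Implicit Defensive.

Import GRing.Theory.
Local Open Scope classical_set_scope.
Local Open Scope ring_scope.

(** * Row spaces and ideals of matrix entries *)

Lemma mxtrace_delta_mul (R : comPzRingType) p q (X : 'M[R]_(p, q)) i j :
  \tr (delta_mx j i *m X) = X i j.
Proof.
rewrite /mxtrace (bigD1 j)//= mxE (bigD1 i)//= mxE !eqxx mul1r.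
rewrite !big1 ?addr0// => [l lj|l li]; last by rewrite mxE (negPf li) andbF mul0r.
by rewrite mxE big1// => t _; rewrite mxE (negPf lj) mul0r.
Qed.

Section RowsEntries.
Variables (R : comPzRingType) (k n : nat) (G : 'M[R]_(k, n)).

Definition in_rows p (B : 'M[R]_(p, n)) : Prop := exists D, B = D *m G.

(** The traces [\tr (D *m G)] are exactly the linear combinations of the entries of [G]; a single
    matrix witnesses membership in the ideal. *)
Definition in_entries (a : R) : Prop := exists D, a = \tr (D *m G).

Lemma in_entriesD a b : in_entries a -> in_entries b -> in_entries (a + b).
Proof. by move=> [D ->] [E ->]; exists (D + E); rewrite mulmxDl raddfD. Qed.

Lemma in_entriesM c a : in_entries a -> in_entries (c * a).
Proof. by move=> [D ->]; exists (c *: D); rewrite -scalemxAl mxtraceZ. Qed.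

Lemma in_entries0 : in_entries 0.
Proof. by exists 0; rewrite mul0mx mxtrace0. Qed.

Lemma in_rows_entry p (B : 'M[R]_(p, n)) i j : in_rows B -> in_entries (B i j).
Proof.
by move=> [D ->]; exists (delta_mx j i *m D); rewrite -mulmxA mxtrace_delta_mul.
Qed.

(** The two halves encode surjectivity and injectivity of the determinant map for the module
    presented by [G]: [b * a - 1] makes [a] a unit modulo the ideal, and [C *m B - 1%:M] makes the
    tuple with coordinates [B] generate. *)
Definition Delta_matrix : Prop :=
  (forall a b, in_entries (b * a - 1) ->
     exists B C : 'M[R]_n, in_rows (C *m B - 1%:M) /\ in_entries (\det B - a)) /\
  (forall B C : 'M[R]_n,
     in_rows (C *m B - 1%:M) -> in_entries (\det B - 1) ->
     exists A, \det A = 1 /\ in_rows (B - A)).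
End RowsEntries.

Lemma in_rows_col_mx0 (R : comPzRingType) k l n p
    (G : 'M[R]_(k, n)) (B : 'M[R]_(p, n)) :
  in_rows (col_mx G (0 : 'M_(l, n))) B -> in_rows G B.
Proof.
by move=> [D ->]; exists (lsubmx D); rewrite -{1}(hsubmxK D) mul_row_col mulmx0 addr0.
Qed.

Lemma in_entries_col_mx0 (R : comPzRingType) k l n (G : 'M[R]_(k, n)) a :
  in_entries (col_mx G (0 : 'M_(l, n))) a -> in_entries G a.
Proof.
by move=> [D ->]; exists (lsubmx D); rewrite -{1}(hsubmxK D) mul_row_col mulmx0 addr0.
Qed.

(** * Ring morphisms and descent to quotient rings *)

Section Morphism.
Variables (R S : comPzRingType) (f : {rmorphism R -> S}).

Lemma in_rows_map k n p (G : 'M[R]_(k, n)) (B : 'M[R]_(p, n)) :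
  in_rows G B -> in_rows (map_mx f G) (map_mx f B).
Proof. by move=> [D ->]; exists (map_mx f D); rewrite map_mxM. Qed.

Lemma in_entries_map k n (G : 'M[R]_(k, n)) a :
  in_entries G a -> in_entries (map_mx f G) (f a).
Proof. by move=> [D ->]; exists (map_mx f D); rewrite -map_mxM trace_map_mx. Qed.

End Morphism.

(* New relations that vanish under [f] may be added to a lift of [G]: they turn
   congruences modulo [G] into congruences modulo the lift. *)
Lemma Delta_matrix_quotient (R S : comPzRingType) (f : {rmorphism R -> S}) n :
  (0 < n)%N -> (forall b, exists a, f a = b) ->
  (forall k (G : 'M[R]_(k, n)), Delta_matrix G) ->
  forall k (G : 'M[S]_(k, n)), Delta_matrix G.
Proof.
move=> n_gt0 f_surj DR k G.
have lift p q (A : 'M[S]_(p, q)) : exists B, map_mx f B = A.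
  have [g gK] := choice f_surj.
  by exists (map_mx g A); apply/matrixP => i j; rewrite !mxE gK.
have map0 k' l (G' : 'M_(k', n)) (H : 'M_(l, n)) : map_mx f H = 0 ->
    map_mx f (col_mx G' H) = col_mx (map_mx f G') 0.
  by move=> fH; rewrite map_col_mx fH.
have [g gG] := lift _ _ G; pose i0 := Ordinal n_gt0.
(* A relation row carrying the scalar [j] in column [i0]; scalar corrections to a congruence enter
   through it. *)
pose J (j : R) : 'M[R]_(1, n) := j *: delta_mx 0 i0.
have fJ j : f j = 0 -> map_mx f (J j) = 0.
  by move=> fj; rewrite map_mxZ fj scale0r.
have trJ j : \tr (delta_mx i0 0 *m J j) = j.
  by rewrite mxtrace_delta_mul !mxE !eqxx mulr1.
split=> [a b [D Dab]|B C [D DBC] [E EB]].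
  have [a' ea] := f_surj a; have [b' eb] := f_surj b; have [D' eD] := lift _ _ D.
  (* The defect of the lifted congruence; it lies in the kernel of [f]. *)
  pose j := b' * a' - 1 - \tr (D' *m g).
  have fj : f j = 0.
    by rewrite !rmorphB rmorphM rmorph1 -trace_map_mx map_mxM ea eb eD gG -Dab subrr.
  have [] := (DR _ (col_mx g (J j))).1 a' b'.
    exists (row_mx D' (delta_mx i0 0)).
    by rewrite mul_row_col mxtraceD trJ /j [RHS]addrC subrK.
  move=> B [C [/(in_rows_map f) BC /(in_entries_map f) Ba]].
  exists (map_mx f B), (map_mx f C); move: BC Ba.
  rewrite map0 ?fJ// gG map_mxB map_mxM map_mx1 rmorphB ea -det_map_mx.
  by move=> /in_rows_col_mx0 ? /in_entries_col_mx0.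
have [B' eB] := lift _ _ B; have [C' eC] := lift _ _ C.
have [D' eD] := lift _ _ D; have [E' eE] := lift _ _ E.
pose j := \det B' - 1 - \tr (E' *m g).
have fj : f j = 0.
  by rewrite !rmorphB rmorph1 -det_map_mx -trace_map_mx map_mxM eB eE gG -EB subrr.
(* The matrix congruence has its own defect, adjoined as [n] further rows. *)
pose H := C' *m B' - 1%:M - D' *m g.
have fH : map_mx f H = 0.
  by rewrite !map_mxB !map_mxM map_mx1 eB eC eD gG -DBC subrr.
have fJH : map_mx f (col_mx (J j) H) = 0 by rewrite map_col_mx fJ// fH col_mx0.
have [||A [A1 BA]] := (DR _ (col_mx g (col_mx (J j) H))).2 B' C'.
- exists (row_mx D' (row_mx 0 1%:M)).
  by rewrite !mul_row_col mul0mx add0r mul1mx [RHS]addrC subrK.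
- exists (row_mx E' (row_mx (delta_mx i0 0) 0)).
  by rewrite !mul_row_col mul0mx addr0 mxtraceD trJ [RHS]addrC subrK.
exists (map_mx f A); rewrite det_map_mx A1 rmorph1; split=> //.
by move: (in_rows_map f BA); rewrite map0// gG map_mxB eB => /in_rows_col_mx0.
Qed.

(** * Products of rings *)

Section Projection.
Variables (X : Type) (R : X -> comPzRingType) (x : X).

Definition prod_proj (f : prod_ring R) : R x := f x.

Let prod_proj_zmod : zmod_morphism prod_proj. Proof. by []. Qed.
Let prod_proj_monoid : monoid_morphism prod_proj. Proof. by []. Qed.

HB.instance Definition _ :=
  GRing.isZmodMorphism.Build (prod_ring R) (R x) prod_proj prod_proj_zmod.
HB.instance Definition _ :=
  GRing.isMonoidMorphism.Build (prod_ring R) (R x) prod_proj prod_proj_monoid.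
End Projection.

Section Product.
Variables (X : Type) (R : X -> comPzRingType).

Lemma prod_ringP (a b : prod_ring R) :
  (forall x, prod_proj x a = prod_proj x b) -> a = b.
Proof. by move=> ab; apply: functional_extensionality_dep => x; exact: ab. Qed.

Lemma prod_mxP p q (A B : 'M[prod_ring R]_(p, q)) :
  (forall x, map_mx (prod_proj x) A = map_mx (prod_proj x) B) -> A = B.
Proof.
move=> AB; apply/matrixP => i j; apply: prod_ringP => x.
by have /matrixP/(_ i j) := AB x; rewrite !mxE.
Qed.

Lemma prod_mx_lift p q (A : forall x, 'M[R x]_(p, q)) :
  exists B : 'M[prod_ring R]_(p, q), forall x, map_mx (prod_proj x) B = A x.
Proof.
exists (\matrix_(i, j) ((fun x => A x i j) : prod_ring R)) => x.
by apply/matrixP => i j; rewrite !mxE.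
Qed.

Lemma in_rows_prod k n p (G : 'M[prod_ring R]_(k, n)) (B : 'M_(p, n)) :
  (forall x, in_rows (map_mx (prod_proj x) G) (map_mx (prod_proj x) B)) ->
  in_rows G B.
Proof.
move=> GB; have [D DE] := prod_mx_lift (fun x => sval (cid (GB x))).
by exists D; apply: prod_mxP => x; rewrite map_mxM DE; case: cid.
Qed.

Lemma in_entries_prod k n (G : 'M[prod_ring R]_(k, n)) a :
  (forall x, in_entries (map_mx (prod_proj x) G) (prod_proj x a)) ->
  in_entries G a.
Proof.
move=> Ga; have [D DE] := prod_mx_lift (fun x => sval (cid (Ga x))).
exists D; apply: prod_ringP => x.
by rewrite -trace_map_mx map_mxM DE; case: cid.
Qed.

(** All conditions on the witnesses can be tested in each factor, so witnesses chosen there glue. *)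
Lemma Delta_matrix_prod k n (G : 'M[prod_ring R]_(k, n)) :
  (forall x, Delta_matrix (map_mx (prod_proj x) G)) -> Delta_matrix G.
Proof.
move=> DG; split=> [a b ab|B C BC B1].
  have H x : exists BC : 'M[R x]_n * 'M[R x]_n,
      in_rows (map_mx (prod_proj x) G) (BC.2 *m BC.1 - 1%:M) /\
      in_entries (map_mx (prod_proj x) G) (\det BC.1 - prod_proj x a).
    have [|B [C BC]] := (DG x).1 (prod_proj x a) (prod_proj x b).
      by have := in_entries_map (prod_proj x) ab; rewrite rmorphB rmorphM rmorph1.
    by exists (B, C).
  have [B BE] := prod_mx_lift (fun x => (sval (cid (H x))).1).
  have [C CE] := prod_mx_lift (fun x => (sval (cid (H x))).2).
  exists B, C; split.
    apply: in_rows_prod => x; rewrite map_mxB map_mxM map_mx1 BE CE.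
    by case: cid => ? [].
  apply: in_entries_prod => x; rewrite rmorphB -det_map_mx BE.
  by case: cid => ? [].
have H x : exists A : 'M[R x]_n, \det A = 1 /\
    in_rows (map_mx (prod_proj x) G) (map_mx (prod_proj x) B - A).
  apply: ((DG x).2 _ (map_mx (prod_proj x) C)).
    by have := in_rows_map (prod_proj x) BC; rewrite map_mxB map_mxM map_mx1.
  by have := in_entries_map (prod_proj x) B1; rewrite rmorphB rmorph1 -det_map_mx.
have [A AE] := prod_mx_lift (fun x => sval (cid (H x))).
exists A; split.
  by apply: prod_ringP => x; rewrite -det_map_mx AE rmorph1; case: cid => ? [].
by apply: in_rows_prod => x; rewrite map_mxB AE; case: cid => ? [].
Qed.
End Product.

(** * Linear combinations and the matrix action on tuples *)

Section TupleAction.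
Variables (R : comPzRingType) (M : lmodType R).

Lemma lincombP n a (c d : 'rV[R]_n) (m : 'rV[M]_n) :
  lincomb (a *: c + d) m = a *: lincomb c m + lincomb d m.
Proof.
rewrite /lincomb scaler_sumr -big_split/=; apply: eq_bigr => j _.
by rewrite !mxE scalerDl scalerA.
Qed.

Lemma lincombD n (c d : 'rV[R]_n) (m : 'rV[M]_n) :
  lincomb (c + d) m = lincomb c m + lincomb d m.
Proof. by rewrite -[c in LHS]scale1r lincombP scale1r. Qed.

Lemma lincombB n (c d : 'rV[R]_n) (m : 'rV[M]_n) :
  lincomb (c - d) m = lincomb c m - lincomb d m.
Proof. by rewrite [c - d]addrC -[- d]scaleN1r lincombP scaleN1r [LHS]addrC. Qed.

Lemma lincomb_delta n (m : 'rV[M]_n) i : lincomb (delta_mx 0 i) m = m 0 i.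
Proof.
rewrite /lincomb (bigD1 i)//= big1 ?addr0 => [|j /negPf ji].
  by rewrite mxE !eqxx scale1r.
by rewrite mxE ji scale0r.
Qed.

Lemma lincomb_mul p n (c : 'rV[R]_p) (B : 'M[R]_(p, n)) (m : 'rV[M]_n) :
  lincomb c (\row_j lincomb (row j B) m) = lincomb (c *m B) m.
Proof.
rewrite /lincomb; under eq_bigr do rewrite mxE scaler_sumr.
rewrite exchange_big/=; apply: eq_bigr => i _; rewrite mxE scaler_suml.
by apply: eq_bigr => j _; rewrite scalerA !mxE.
Qed.

(** Coordinates are kept in rows, whereas the right action reads columns; hence the transposes from
    here on. *)
Lemma tuple_act_rows n (m : 'rV[M]_n) (B : 'M[R]_n) :
  tuple_act m B^T = \row_j lincomb (row j B) m.
Proof. by apply/rowP => j; rewrite !mxE; apply: eq_bigr => i _; rewrite !mxE. Qed.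

Lemma tuple_actM n (m : 'rV[M]_n) (A B : 'M[R]_n) :
  tuple_act (tuple_act m A) B = tuple_act m (A *m B).
Proof.
rewrite -[A]trmxK -[B]trmxK -trmx_mul !tuple_act_rows; apply/rowP => j.
by rewrite !mxE lincomb_mul -row_mul.
Qed.

Lemma tuple_act1 n (m : 'rV[M]_n) : tuple_act m 1%:M = m.
Proof. by apply/rowP => j; rewrite -trmx1 tuple_act_rows mxE row1 lincomb_delta. Qed.
End TupleAction.

(** * Alternating maps and determinants *)

Section AlternatingMaps.
Variables (R : comPzRingType) (V W : lmodType R) (n : nat).
Implicit Types (f : 'rV[V]_n -> W) (m : 'rV[V]_n).

Definition alternating_map f : Prop :=
  (forall m i a x y, f (set_comp m i (a *: x + y)) =
     a *: f (set_comp m i x) + f (set_comp m i y)) /\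
  (forall m i j, i != j -> m 0 i = m 0 j -> f m = 0).

Lemma set_comp_id m i : set_comp m i (m 0 i) = m.
Proof. by apply/rowP => j; rewrite mxE; case: eqVneq => // ->. Qed.

Lemma set_compE m i x j : set_comp m i x 0 j = if j == i then x else m 0 j.
Proof. by rewrite mxE. Qed.

Lemma set_compC m i j x y : i != j ->
  set_comp (set_comp m i x) j y = set_comp (set_comp m j y) i x.
Proof.
move=> ij; apply/rowP => l; rewrite !set_compE; case: (eqVneq l i) => // ->.
by rewrite (negPf ij).
Qed.

Variable f : 'rV[V]_n -> W.
Hypothesis f_alt : alternating_map f.

Lemma alternating_mapD m i x y :
  f (set_comp m i (x + y)) = f (set_comp m i x) + f (set_comp m i y).
Proof. by rewrite -{1}[x]scale1r f_alt.1 scale1r. Qed.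

Lemma alternating_map0 m i : f (set_comp m i 0) = 0.
Proof. by apply: (@addrI _ (f (set_comp m i 0))); rewrite -alternating_mapD !addr0. Qed.

Lemma alternating_mapZ m i a x : f (set_comp m i (a *: x)) = a *: f (set_comp m i x).
Proof. by rewrite -[a *: x]addr0 f_alt.1 alternating_map0 addr0. Qed.

Lemma alternating_map_sum m i (I : finType) (P : pred I) (a : I -> R) (x : I -> V) :
  f (set_comp m i (\sum_(l | P l) a l *: x l)) =
  \sum_(l | P l) a l *: f (set_comp m i (x l)).
Proof.
apply: (big_ind2 (fun u v => f (set_comp m i u) = v)).
- exact: alternating_map0.
- by move=> u _ v _ <- <-; rewrite alternating_mapD.
- by move=> l _; rewrite alternating_mapZ.
Qed.

(** With [m 0 i + m 0 j] placed in both positions the value is 0, and only the two mixed terms of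
    its expansion survive. *)
Lemma alternating_map_tperm m i j : i != j ->
  f (\row_l m 0 (tperm i j l)) = - f m.
Proof.
move=> ij; pose g x y := f (set_comp (set_comp m i x) j y).
have gD1 x x' y : g (x + x') y = g x y + g x' y.
  by rewrite /g !(set_compC _ _ _ ij) alternating_mapD.
have gD2 x y y' : g x (y + y') = g x y + g x y' by rewrite /g alternating_mapD.
have gxx x : g x x = 0.
  by apply: (f_alt.2 _ i j ij); rewrite !set_compE eqxx (negPf ij) eqxx.
have gE : g (m 0 i) (m 0 j) = f m.
  rewrite /g set_comp_id; congr f; apply/rowP => l; rewrite !set_compE.
  by case: (eqVneq l j) => // ->.
have gE' : g (m 0 j) (m 0 i) = f (\row_l m 0 (tperm i j l)).
  rewrite /g; congr f; apply/rowP => l; rewrite !set_compE !mxE.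
  case: tpermP => [->|->|/eqP/negPf-> /eqP/negPf-> //]; rewrite ?eqxx//.
  by rewrite (negPf ij).
have := gxx (m 0 i + m 0 j); rewrite gD1 !gD2 !gxx add0r addr0 gE gE'.
by move/eqP; rewrite addrC addr_eq0 => /eqP.
Qed.

Lemma alternating_map_perm m (s : 'S_n) :
  f (\row_l m 0 (s l)) = (-1) ^+ s *: f m.
Proof.
have [ts -> {s}] := prod_tpermP s.
elim: ts m => [|[i j] ts IH] m /=.
  move=> _; rewrite big_nil odd_perm1 expr0 scale1r.
  by congr f; apply/rowP => l; rewrite mxE perm1.
move=> /andP[ij /IH tsP]; rewrite big_cons odd_mul_tperm ij.
have -> : \row_l m 0 ((tperm i j * \prod_(t <- ts) tperm t.1 t.2)%g l) =
    \row_l (\row_u m 0 ((\prod_(t <- ts) tperm t.1 t.2)%g u)) 0 (tperm i j l).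
  by apply/rowP => l; rewrite !mxE permM.
by rewrite alternating_map_tperm// tsP signr_addb expr1 mulN1r scaleNr.
Qed.
End AlternatingMaps.

Lemma det_alternating (R : comPzRingType) n :
  alternating_map (fun X : 'rV['rV[R]_n]_n => \det (\matrix_i X 0 i) : R^o).
Proof.
split=> [m i a x y|m i j ij mij]; last first.
  by apply: (determinant_alternate ij) => l; rewrite !mxE mij.
rewrite -[X in _ = _ + X]mul1r; apply: (@determinant_multilinear _ _ _ _ _ i).
- by rewrite !rowK !set_compE eqxx scale1r.
- by apply/matrixP => l u; rewrite !mxE eq_sym (negPf (neq_lift _ _)).
- by apply/matrixP => l u; rewrite !mxE eq_sym (negPf (neq_lift _ _)).
Qed.

(* Replacing the components one by one by basis vectors reduces to a tuple of
   basis vectors, where either two components agree or a permutation acts. *)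
Lemma alternating_map_free (R : comPzRingType) (W : lmodType R) n
    (f : 'rV['rV[R]_n]_n -> W) : alternating_map f ->
  forall X, f X = \det (\matrix_i X 0 i) *: f (\row_i delta_mx 0 i).
Proof.
move=> f_alt; pose d (X : 'rV['rV[R]_n]_n) : R^o := \det (\matrix_i X 0 i).
have d_alt : alternating_map d := @det_alternating R n.
(* Only the first [k] components may differ from basis vectors; for [k = n] this is no condition. *)
suff P k (X : 'rV['rV[R]_n]_n) :
    (forall j : 'I_n, (k <= j)%N -> exists i, X 0 j = delta_mx 0 i) ->
    f X = d X *: f (\row_i delta_mx 0 i).
  by move=> X; apply: (P n) => j; rewrite leqNgt ltn_ord.
elim: k X => [|k IH] X Xdelta.
  have [g gE] := choice (fun j => Xdelta j (leq0n _)).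
  (* An injective [g] is a permutation and both sides carry its sign; otherwise both sides
     vanish. *)
  have [/injectiveP g_inj|/injectivePn[i [j ij gij]]] := boolP (injectiveb g).
    have -> : X = \row_i (\row_i delta_mx 0 i) 0 (perm g_inj i).
      by apply/rowP => j; rewrite gE !mxE permE.
    rewrite !alternating_map_perm//; congr (_ *: _); rewrite [LHS](esym (mulr1 _)).
    congr (_ * _); rewrite /d -[LHS](@det1 R n); congr (\det _).
    by apply/row_matrixP => i; rewrite rowK row1 mxE.
  have Xij : X 0 i = X 0 j by rewrite !gE gij.
  by rewrite (f_alt.2 _ _ _ ij Xij) (d_alt.2 _ _ _ ij Xij) scale0r.
have [kn|nk] := ltnP k n; last first.
  by apply: IH => j kj; have := leq_ltn_trans kj (ltn_ord j); rewrite ltnNge nk.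
pose k' := Ordinal kn.
(* Both sides are linear in component [k'], which is expanded in the standard basis. *)
rewrite -(set_comp_id X k') (row_sum_delta (X 0 k')) !alternating_map_sum//.
rewrite scaler_suml; apply: eq_bigr => i _.
rewrite -scalerA; congr (_ *: _); apply: IH => j kj; rewrite set_compE.
case: eqVneq => [_|jk]; first by exists i.
apply: Xdelta; rewrite ltn_neqAle kj eq_sym andbT.
by apply: contra jk => /eqP ?; apply/eqP/val_inj.
Qed.

(** Composed with [L], which sends coordinate rows to combinations of [m], the map becomes
    alternating on a free module, where it is a multiple of the determinant. *)
Lemma alternating_map_act (R : comPzRingType) (V W : lmodType R) n
    (f : 'rV[V]_n -> W) (m : 'rV[V]_n) (A : 'M[R]_n) :
  alternating_map f -> f (tuple_act m A) = \det A *: f m.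
Proof.
move=> f_alt; pose L (X : 'rV['rV[R]_n]_n) := \row_i lincomb (X 0 i) m.
have L_comp X i x : L (set_comp X i x) = set_comp (L X) i (lincomb x m).
  by apply/rowP => j; rewrite !mxE; case: eqP.
have fL_alt : alternating_map (f \o L).
  split=> [X i a x y /=|X i j ij Xij /=].
    by rewrite !L_comp lincombP f_alt.1.
  by apply: (f_alt.2 _ _ _ ij); rewrite !mxE Xij.
have := alternating_map_free fL_alt (\row_i row i A^T).
have -> : \matrix_i (\row_i row i A^T) 0 i = A^T.
  by apply/row_matrixP => i; rewrite rowK mxE.
rewrite det_tr /=; congr (_ = _).
  by congr f; rewrite -[A in RHS]trmxK tuple_act_rows; apply/rowP => i; rewrite !mxE.
by congr (_ *: f _); apply/rowP => i; rewrite !mxE lincomb_delta.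
Qed.

(** * Quotients and linear extension from free modules *)

Lemma span_pred_gen (R : pzRingType) (V : lmodType R) (A : set V) v :
  A v -> v \in span_pred A.
Proof.
move=> Av; apply/span_predP; exists [:: (1, v)]; rewrite big_seq1 scale1r.
by split=> // p; rewrite inE => /eqP->.
Qed.

Lemma quotmod_pi_eq0 (R : pzRingType) (V : lmodType R) (A : set V) v :
  quotmod_pi A v = 0 <-> v \in span_pred A.
Proof.
split=> [v0|vA]; last first.
  by rewrite -(raddf0 (quotmod_pi A)); apply/quotmod_eqP; rewrite subr0.
by rewrite -[v]subr0; apply/quotmod_eqP; rewrite raddf0.
Qed.

Section FreeModuleTheory.
Variables (R : pzRingType) (T : choiceType).
Implicit Types f g : freemod R T.

Lemma freemod_support f : finite_set [set t | f t != 0].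
Proof. exact: (asboolW (freemod_valP f)). Qed.

Lemma freemod_basis_sum f (s : seq T) : uniq s -> [set t | f t != 0] `<=` [set` s] ->
  f = \sum_(t <- s) (f t : R) *: freemod_basis R t.
Proof.
move=> s_uniq fs; apply: val_inj; apply: functional_extensionality_dep => u /=.
rewrite (big_morph (fun g : freemod R T => g u) (id1 := 0) (op1 := +%R))//.
transitivity (\sum_(t <- s) (f t : R) * (u == t)%:R); last by [].
have [us|us] := boolP (u \in s).
  rewrite (big_rem u)//= big_seq big1 ?addr0 ?eqxx ?mulr1// => t.
  by rewrite mem_rem_uniq// inE eq_sym => /andP[/negPf-> _]; rewrite mulr0.
rewrite big_seq big1 => [|t ts]; first by apply/eqP/negPn; apply: contra us => /(fs u).
by case: eqVneq us => [->|]; rewrite ?ts// mulr0.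
Qed.

Variables (W : lmodType R) (phi : T -> W).

Definition freemod_ext f : W := \sum_(t \in [set t | f t != 0]) (f t : R) *: phi t.

(** Any duplicate-free list covering the support may index the sum, so values at different functions
    can be compared over one list. *)
Lemma freemod_extE f (s : seq T) : uniq s -> [set t | f t != 0] `<=` [set` s] ->
  freemod_ext f = \sum_(t <- s) (f t : R) *: phi t.
Proof.
move=> s_uniq fs; apply: fsbig_fwiden => // t [_ /= /negP].
by rewrite negbK => /eqP->; rewrite scale0r.
Qed.

Lemma freemod_extP : linear freemod_ext.
Proof.
move=> a f g.
have := freemod_support f; have := freemod_support g.
move=> /finite_seqP[sg gs] /finite_seqP[sf fs]; pose s := undup (sf ++ sg).
have s_uniq : uniq s := undup_uniq _.
have fS : [set t | f t != 0] `<=` [set` s].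
  by rewrite fs => t /=; rewrite mem_undup mem_cat => ->.
have gS : [set t | g t != 0] `<=` [set` s].
  by rewrite gs => t /=; rewrite mem_undup mem_cat => ->; rewrite orbT.
have fgE t : (a *: f + g : freemod R T) t = a * f t + g t by [].
have fgS : [set t | (a *: f + g : freemod R T) t != 0] `<=` [set` s].
  move=> t; have [ft0|/(fS t)//] := eqVneq (f t) 0.
  have [gt0 /eqP[]|/(gS t)//] := eqVneq (g t) 0.
  by apply: etrans (fgE t) _; rewrite ft0 gt0 mulr0 addr0.
rewrite (freemod_extE s_uniq fS) (freemod_extE s_uniq gS) (freemod_extE s_uniq fgS).
rewrite scaler_sumr -big_split/=; apply: eq_bigr => t _.
by rewrite scalerA -scalerDl.
Qed.

HB.instance Definition _ :=
  GRing.isLinear.Build R (freemod R T) W *:%R freemod_ext freemod_extP.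

Lemma freemod_ext_basis t : freemod_ext (freemod_basis R t) = phi t.
Proof.
have tS : [set u | freemod_basis R t u != 0] `<=` [set` [:: t]].
  by move=> u /=; rewrite inE; case: (eqVneq u t) => //=; rewrite eqxx.
by rewrite (freemod_extE _ tS)// big_seq1/= eqxx scale1r.
Qed.
End FreeModuleTheory.

(** * Exterior powers *)

Section ExteriorPowerTheory.
Variables (R : comPzRingType) (M : lmodType R) (n : nat).

Lemma wedge_alternating : alternating_map (@wedge R M n).
Proof.
split=> [m i a x y|m i j ij mij].
  rewrite /wedge -linearZ -raddfD; apply/quotmod_eqP/span_pred_gen; left.
  by exists m, i, a, x, y.
by apply/quotmod_pi_eq0/span_pred_gen; right; exists m, i, j.
Qed.

Lemma wedge_act (m : 'rV[M]_n) (A : 'M[R]_n) :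
  wedge (tuple_act m A) = \det A *: wedge m.
Proof. exact: alternating_map_act wedge_alternating. Qed.

(** The wedges span, being the images of the basis of the free module. *)
Lemma extpow_ind (P : extpow M n -> Prop) :
  P 0 -> (forall a m q, P q -> P (a *: wedge m + q)) -> forall q, P q.
Proof.
move=> P0 PD q; rewrite -(quotmod_pi_repr q); set f := repr _.
have /finite_seqP[s fs] := freemod_support f.
rewrite (@freemod_basis_sum _ _ f (undup s)) ?undup_uniq//; last first.
  by rewrite fs => t /=; rewrite mem_undup.
elim: (undup s) => [|t r IH]; first by rewrite big_nil raddf0.
by rewrite big_cons raddfD [X in X + _](linearZ_LR (quotmod_pi _)); exact: PD.
Qed.

(** The linear extension of [f] to the free module kills both kinds of relations, hence factors
    through the exterior power. *)
Lemma alternating_map_wedge_eq0 (W : lmodType R) (f : 'rV[M]_n -> W) a m :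
  alternating_map f -> a *: wedge m = 0 -> a *: f m = 0.
Proof.
move=> f_alt am0; have := etrans (linearZ_LR (quotmod_pi _) a (freemod_basis R m)) am0.
move=> /quotmod_pi_eq0/span_predP[s [sA]].
move=> /(congr1 (freemod_ext f)); rewrite linearZ_LR/= freemod_ext_basis => ->.
rewrite linear_sum big_seq big1// => p /sA pA; rewrite linearZ_LR/=.
suff -> : freemod_ext f p.2 = 0 by rewrite scaler0.
case: pA => [[u [i [b [x [y ->]]]]]|[u [i [j [ij uij ->]]]]].
  by rewrite linearB linearP/= !freemod_ext_basis f_alt.1 subrr.
by rewrite freemod_ext_basis (f_alt.2 _ _ _ ij uij).
Qed.
End ExteriorPowerTheory.

(** * Presentations and the top exterior power *)

Lemma in_rows_row (R : comPzRingType) k n p (G : 'M[R]_(k, n)) (B : 'M[R]_(p, n)) :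
  in_rows G B <-> forall j, in_rows G (row j B).
Proof.
split=> [[D ->] j|/choice[d dE]]; first by exists (row j D); rewrite row_mul.
exists (\matrix_j d j); apply/row_matrixP => j.
by rewrite dE row_mul rowK.
Qed.

(** The entries are congruent modulo the ideal, so the Leibniz expansions agree term by term and
    factor by factor. *)
Lemma in_entries_det (R : comPzRingType) k n (G : 'M[R]_(k, n)) (B C : 'M[R]_n) :
  in_rows G (B - C) -> in_entries G (\det B - \det C).
Proof.
move=> BC; pose P a b := in_entries G (a - b).
apply: (big_ind2 P) => [|a a' b b' aP bP|s _]; rewrite /P.
- by rewrite subrr; exact: in_entries0.
- by rewrite opprD addrACA; exact: in_entriesD.
rewrite -mulrBr; apply: in_entriesM.
apply: (big_ind2 P) => [|a a' b b' aP bP|i _]; rewrite /P.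
- by rewrite subrr; exact: in_entries0.
- have -> : a * b - a' * b' = b * (a - a') + a' * (b - b').
    by rewrite !mulrBr addrA [b * a]mulrC [b * a']mulrC subrK.
  by apply: in_entriesD; exact: in_entriesM.
- by have := in_rows_entry i (s i) BC; rewrite !mxE.
Qed.

Definition presents (R : comPzRingType) (M : lmodType R) k n (m : 'rV[M]_n)
    (G : 'M[R]_(k, n)) : Prop :=
  gen_tuples M n m /\ forall c : 'rV[R]_n, lincomb c m = 0 <-> in_rows G c.

Section Presentation.
Variables (R : comPzRingType) (M : lmodType R) (k n : nat).
Variables (m : 'rV[M]_n) (G : 'M[R]_(k, n)).

Lemma gen_tuples_rows p (u : 'rV[M]_p) : gen_tuples M n m ->
  exists B : 'M[R]_(p, n), u = \row_j lincomb (row j B) m.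
Proof.
move=> mG; have [c cE] := choice (fun j => mG (u 0 j)).
by exists (\matrix_j c j); apply/rowP => j; rewrite mxE rowK cE.
Qed.

Lemma gen_tuples_act (u : 'rV[M]_n) : gen_tuples M n m ->
  exists B : 'M[R]_n, u = tuple_act m B^T.
Proof. by move=> /(gen_tuples_rows u)[B ->]; exists B; rewrite tuple_act_rows. Qed.

(** Each wedge is the determinant of a coordinate matrix times [wedge m], and wedges span. *)
Lemma gen_tuples_wedge (w : extpow M n) : gen_tuples M n m ->
  exists a, w = a *: wedge m.
Proof.
move=> mG; elim/extpow_ind: w => [|a u _ [b ->]]; first by exists 0; rewrite scale0r.
have [B ->] := gen_tuples_act u mG.
by exists (a * \det B^T + b); rewrite wedge_act scalerDl scalerA.
Qed.

Hypothesis mG : presents m G.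

Lemma presents_eq (B C : 'M[R]_n) :
  tuple_act m B^T = tuple_act m C^T <-> in_rows G (B - C).
Proof.
rewrite !tuple_act_rows in_rows_row; split=> [/rowP BC j|BC].
  by apply/mG.2; have := BC j; rewrite !mxE raddfB lincombB => ->; rewrite subrr.
apply/rowP => j; rewrite !mxE; apply/eqP; rewrite -subr_eq0 -lincombB -raddfB.
by apply/eqP/mG.2; exact: BC.
Qed.

(** The new tuple generates as soon as it yields [m] back; [C] holds the coordinates of [m] in
    it. *)
Lemma presents_gen (B : 'M[R]_n) :
  gen_tuples M n (tuple_act m B^T) <-> exists C, in_rows G (C *m B - 1%:M).
Proof.
split=> [BG|[C CB] x].
  have /choice[c cE] := fun j => BG (m 0 j).
  exists (\matrix_j c j); apply/presents_eq; rewrite trmx1 tuple_act1.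
  rewrite trmx_mul -tuple_actM tuple_act_rows; apply/rowP => j.
  by rewrite mxE rowK cE.
have [c ->] := mG.1 x; exists (c *m C).
have /presents_eq := CB; rewrite trmx1 tuple_act1 => {1}<-.
by rewrite trmx_mul -tuple_actM [in LHS]tuple_act_rows lincomb_mul.
Qed.

(** Chosen coordinates, additive and homogeneous only modulo the rows of [G]; their determinants are
    therefore taken in [W], the ring modulo the ideal of entries. *)
Let coef (x : M) : 'rV[R]_n := sval (cid (mG.1 x)).
Let coefP x : lincomb (coef x) m = x.
Proof. by rewrite /coef; case: cid. Qed.

Let coef_mx (u : 'rV[M]_n) : 'M[R]_n := \matrix_j coef (u 0 j).

Let W := quotmod [set a : R^o | in_entries G a].

Let W_eq0 a : quotmod_pi [set a : R^o | in_entries G a] a = 0 <-> in_entries G a.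
Proof.
split=> [/quotmod_pi_eq0/span_predP[s [sA ->]]|aG].
  rewrite big_seq; apply: (big_ind (in_entries G)) => [|a' b|p ps].
  - exact: in_entries0.
  - exact: in_entriesD.
  - exact/in_entriesM/sA.
by apply/quotmod_pi_eq0; exact: span_pred_gen.
Qed.

Let det_mod (u : 'rV[M]_n) : W := quotmod_pi _ (\det (coef_mx u) : R^o).

Let det_mod_lift (u : 'rV[M]_n) (B : 'M[R]_n) :
  u = tuple_act m B^T -> det_mod u = quotmod_pi _ (\det B : R^o).
Proof.
move=> uB; apply/quotmod_eqP/span_pred_gen; apply: in_entries_det.
apply/presents_eq; rewrite -uB tuple_act_rows; apply/rowP => j.
by rewrite mxE rowK coefP.
Qed.

Let det_mod_alternating : alternating_map det_mod.
Proof.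
have dE (X : 'rV['rV[R]_n]_n) : det_mod (\row_i lincomb (X 0 i) m) =
    quotmod_pi _ (\det (\matrix_i X 0 i) : R^o).
  by apply: det_mod_lift; rewrite tuple_act_rows; apply/rowP => i; rewrite !mxE rowK.
have compE (u : 'rV[M]_n) i x c : lincomb c m = x -> set_comp u i x =
    \row_j lincomb (set_comp (\row_j coef (u 0 j)) i c 0 j) m.
  by move=> <-; apply/rowP => j; rewrite !mxE; case: eqP => // _; rewrite coefP.
split=> [u i a x y|u i j ij uij].
  (* The coordinates chosen for [a *: x + y] are traded for the combination of those of [x] and [y],
     which leaves the class in [W] unchanged. *)
  rewrite (compE u i _ (a *: coef x + coef y)) ?lincombP ?coefP//.
  rewrite (compE u i _ _ (coefP x)) (compE u i _ _ (coefP y)) !dE.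
  by rewrite (det_alternating R n).1 linearP.
apply: etrans (raddf0 (quotmod_pi _)); congr quotmod_pi.
by apply: (determinant_alternate ij) => l; rewrite !mxE uij.
Qed.

(* The ideal of entries of [G] annihilates the wedge because each relation
   among the generators may be substituted for a component; conversely the
   determinant of coordinates modulo this ideal is alternating and sends [m]
   to 1. *)
Lemma presents_wedge_eq0 a : a *: wedge m = 0 <-> in_entries G a.
Proof.
split=> [/(alternating_map_wedge_eq0 det_mod_alternating)|[D ->]].
  rewrite (@det_mod_lift m 1%:M) ?trmx1 ?tuple_act1// det1.
  move=> /(etrans (linearZ_LR (quotmod_pi _) a (1 : R^o))) /W_eq0.
  by rewrite /GRing.scale/= mulr1.
rewrite /mxtrace; under eq_bigr do rewrite mxE.
rewrite scaler_suml big1// => i _; rewrite scaler_suml big1// => j _.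
have /mG.2 mj : in_rows G (row j G) by exists (delta_mx 0 j); rewrite -rowE.
rewrite -scalerA; suff -> : G j i *: wedge m = 0 by rewrite scaler0.
have := alternating_map0 (@wedge_alternating _ M n) m i; rewrite -mj /lincomb.
rewrite (alternating_map_sum (@wedge_alternating _ M n)) (bigD1 i)//= set_comp_id.
(* For [l] other than [i], the component [m 0 l] occurs twice. *)
rewrite big1 ?addr0 ?mxE// => l li.
rewrite ((@wedge_alternating _ M n).2 _ _ _ li) ?scaler0//.
by rewrite !set_compE eqxx (negPf li).
Qed.

Lemma presents_wedge_act (B : 'M[R]_n) a :
  wedge (tuple_act m B^T) = a *: wedge m <-> in_entries G (\det B - a).
Proof.
rewrite wedge_act det_tr -presents_wedge_eq0 scalerBl.
by split=> [->|/eqP]; rewrite ?subrr// subr_eq0 => /eqP.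
Qed.

(** Rewriting [u] through [m] and back gives the relations [1%:M - B *m C]; together with the
    relations of [m] carried over, [G *m C], they generate all relations of [u]. *)
Lemma presents_gen_tuple p (u : 'rV[M]_p) : gen_tuples M p u ->
  exists l (H : 'M[R]_(l, p)), presents u H.
Proof.
move=> uG; have [B uE] := gen_tuples_rows u mG.1.
have /choice[c cE] := fun j => uG (m 0 j); pose C := \matrix_j c j.
have mE : m = \row_j lincomb (row j C) u.
  by apply/rowP => j; rewrite mxE rowK cE.
have uC d : lincomb (d *m C) u = lincomb d m by rewrite mE lincomb_mul.
have mB d : lincomb (d *m B) m = lincomb d u by rewrite uE lincomb_mul.
exists _, (col_mx (1%:M - B *m C) (G *m C)); split=> // d; split.
  rewrite -mB => /mG.2[e dE]; exists (row_mx d e).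
  by rewrite mul_row_col mulmxBr mulmx1 !mulmxA dE subrK.
move=> [e ->]; rewrite -(hsubmxK e) mul_row_col mulmxBr mulmx1 !mulmxA.
rewrite lincombD lincombB !uC mB subrr add0r.
by apply/mG.2; exists (rsubmx e).
Qed.
End Presentation.

(** * Numbers of generators and orbits *)

Section Generation.
Variables (R : comPzRingType) (M : lmodType R).

Lemma gen_tuples_leq p q : (p <= q)%N ->
  gen_tuples M p !=set0 -> gen_tuples M q !=set0.
Proof.
move=> /subnKC <- [u uG]; exists (row_mx u 0) => x; have [c ->] := uG x.
exists (row_mx c 0); rewrite /lincomb big_split_ord/=.
rewrite [X in _ = _ + X]big1 ?addr0 => [|i _]; last by rewrite !row_mxEr mxE scale0r.
by apply: eq_bigr => i _; rewrite !row_mxEl.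
Qed.

(** The minimum is attained, so the default of [xget] is not taken, and generating tuples can be
    padded with zeros. *)
Lemma mu_leqP n : finitely_generated M -> (mu M <= n)%N <-> gen_tuples M n !=set0.
Proof.
move=> fg; have [] : [set l | gen_tuples M l !=set0 /\
    forall l', gen_tuples M l' !=set0 -> (l <= l')%N] (mu M).
  apply: xgetPex; have [l /asboolP lG] := fg.
  have [|l' /asboolP l'G l'min] := @ex_minnP (fun l => `[< gen_tuples M l !=set0 >]).
    by exists l.
  by exists l'; split=> // i /asboolP; exact: l'min.
by move=> muG mu_min; split=> [/gen_tuples_leq/(_ muG)|/mu_min].
Qed.

Lemma single_gensP (w : M) : single_gens M w <-> forall x, exists a, x = a *: w.
Proof.
split=> wG x; have [] := wG x.
  by move=> c ->; exists (c 0 0); rewrite /lincomb big_ord1 mxE.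
by move=> a ->; exists a%:M; rewrite /lincomb big_ord1 !mxE eqxx mulr1n.
Qed.

Lemma SL_orbit_refl n (u : 'rV[M]_n) : SL_orbit u u.
Proof. by exists 1%:M; [exact: det1|exact: tuple_act1]. Qed.

Lemma SL_orbit_act n (u : 'rV[M]_n) (A : 'M[R]_n) : \det A = 1 ->
  SL_orbit (tuple_act u A) = SL_orbit u.
Proof.
(* The adjugate is the inverse of [A] and again has determinant 1. *)
move=> A1; have A'1 : \det (\adj A) = 1.
  have := congr1 determinant (mul_mx_adj A).
  by rewrite det_mulmx A1 mul1r det1.
apply/seteqP; split=> _ [B B1 <-].
  by exists (A *m B); rewrite ?tuple_actM// /SL/= det_mulmx A1 B1 mulr1.
exists (\adj A *m B); first by rewrite /SL/= det_mulmx A'1 B1 mulr1.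
by rewrite tuple_actM mulmxA mul_mx_adj A1 mul1mx.
Qed.

Lemma wedge_SL_orbit n (u v : 'rV[M]_n) : SL_orbit u = SL_orbit v -> wedge u = wedge v.
Proof.
move=> uv; have [A A1 <-] : SL_orbit v u by rewrite -uv; exact: SL_orbit_refl.
by rewrite wedge_act (A1 : _ = _) scale1r.
Qed.
End Generation.

(** * Equivalence of the module and matrix conditions *)

Definition Delta_SL_at (R : comPzRingType) (M : lmodType R) n : Prop :=
  exists phi : set 'rV[M]_n -> extpow M n,
    (forall m, gen_tuples M n m -> phi (SL_orbit m) = wedge m) /\
    set_bij (gen_orbits M n) (single_gens (extpow M n)) phi.

Section DeltaPresentation.
Variables (R : comPzRingType) (M : lmodType R) (n : nat).

Lemma Delta_SL_at_matrix k (m : 'rV[M]_n) (G : 'M[R]_(k, n)) :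
  presents m G -> Delta_SL_at M n -> Delta_matrix G.
Proof.
move=> mG [phi [phiE [_ phi_inj phi_surj]]]; split=> [a b ab|B C BC B1].
  (* Since [b] inverts [a] on [wedge m], the multiple [a *: wedge m] is a single generator and
     surjectivity applies. *)
  have [|_ [m' m'G <-]] := phi_surj (a *: wedge m).
    apply/single_gensP => x; have [c ->] := gen_tuples_wedge x mG.1.
    exists (c * b); rewrite scalerA -mulrA -[RHS]scalerA; congr (_ *: _).
    apply/eqP; rewrite eq_sym -subr_eq0 -[X in _ - X]scale1r -scalerBl; apply/eqP.
    exact/(presents_wedge_eq0 mG).
  rewrite phiE//; have [B m'E] := gen_tuples_act m' mG.1.
  rewrite m'E in m'G *; move=> /(presents_wedge_act mG) Ba.
  by have [C CB] := (presents_gen mG B).1 m'G; exists B, C.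
have m'G : gen_tuples M n (tuple_act m B^T) by apply/(presents_gen mG); exists C.
have /(presents_wedge_act mG) := B1; rewrite scale1r => m'w.
have m'O : SL_orbit (tuple_act m B^T) = SL_orbit m.
  apply: phi_inj; rewrite ?inE; first by exists (tuple_act m B^T).
    by exists m; first exact: mG.1.
  by rewrite !phiE//; exact: mG.1.
have [A A1 mA] : SL_orbit m (tuple_act m B^T) by rewrite -m'O; exact: SL_orbit_refl.
exists A^T; rewrite det_tr; split=> //.
by apply/(presents_eq mG); rewrite trmxK mA.
Qed.

(** A presentation is required on every generating tuple because injectivity compares two arbitrary
    ones, the first serving as generators for the second. *)
Lemma matrix_Delta_SL_at :
  (forall m, gen_tuples M n m ->
     exists k (G : 'M[R]_(k, n)), presents m G /\ Delta_matrix G) ->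
  gen_tuples M n !=set0 -> Delta_SL_at M n.
Proof.
move=> DM [m0 m0G].
(* A representative of the orbit is chosen; the default 0 is reached only on sets that are not
   orbits of generating tuples. *)
pose phi S : extpow M n :=
  wedge (xget 0 [set m | gen_tuples M n m /\ SL_orbit m = S]).
have phiE m : gen_tuples M n m -> phi (SL_orbit m) = wedge m.
  move=> mG; apply: wedge_SL_orbit.
  have [|] // := @xgetPex _ 0 [set u | gen_tuples M n u /\ SL_orbit u = SL_orbit m].
  by exists m.
exists phi; split=> //; split.
- move=> _ [m mG <-]; rewrite phiE//; apply/single_gensP => x.
  exact: gen_tuples_wedge.
- move=> _ _ /set_mem[m mG <-] /set_mem[m' m'G <-]; rewrite !phiE//.
  have [k [G [mP DG]]] := DM m mG.
  have [B m'E] := gen_tuples_act m' mG.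
  rewrite {}m'E in m'G *; have [C CB] := (presents_gen mP B).1 m'G.
  move=> ww; have B1 : in_entries G (\det B - 1).
    by apply/(presents_wedge_act mP); rewrite scale1r.
  have [A [A1 /(presents_eq mP) ->]] := DG.2 B C CB B1.
  by rewrite SL_orbit_act// det_tr.
- move=> w /single_gensP wG; have [k [G [mP DG]]] := DM m0 m0G.
  (* As [w] and [wedge m0] are multiples of each other, [b * a] acts as 1 on [wedge m0]. *)
  have [a wE] := gen_tuples_wedge w m0G; have [b mE] := wG (wedge m0).
  have [|B [C [CB Ba]]] := DG.1 a b.
    apply/(presents_wedge_eq0 mP); rewrite scalerBl scale1r -scalerA -wE -mE.
    exact: subrr.
  have mBG : gen_tuples M n (tuple_act m0 B^T) by apply/(presents_gen mP); exists C.
  exists (SL_orbit (tuple_act m0 B^T)); first by exists (tuple_act m0 B^T).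
  by rewrite phiE// wE; apply/(presents_wedge_act mP).
Qed.
End DeltaPresentation.

Section Cokernel.
Variables (R : comPzRingType) (k n : nat) (G : 'M[R]_(k, n)).

(** Realizes an arbitrary [G] as a relation matrix, so that a condition on all modules reaches all
    matrices. *)
Definition cokernel : lmodType R := quotmod [set v : 'rV[R]_n | in_rows G v].

Definition cokernel_basis : 'rV[cokernel]_n :=
  \row_i quotmod_pi [set v : 'rV[R]_n | in_rows G v] (delta_mx 0 i).

Lemma cokernel_presents : presents cokernel_basis G.
Proof.
set A := [set v : 'rV[R]_n | in_rows G v].
have lcE c : lincomb c cokernel_basis = quotmod_pi A c.
  rewrite [in RHS](row_sum_delta c) linear_sum; apply: eq_bigr => i _.
  by rewrite mxE linearZ.
split=> [x|c]; first by rewrite -(quotmod_pi_repr x); exists (repr x); rewrite lcE.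
rewrite lcE; split=> [/quotmod_pi_eq0/span_predP[s [sA ->]]|cG]; last first.
  by apply/quotmod_pi_eq0; exact: span_pred_gen.
rewrite big_seq; apply: (big_ind (@in_rows _ _ _ G 1)).
- by exists 0; rewrite mul0mx.
- by move=> _ _ [d ->] [e ->]; exists (d + e); rewrite mulmxDl.
- by move=> p /sA[d ->]; exists (p.1 *: d); rewrite scalemxAl.
Qed.
End Cokernel.

Lemma Delta_SL_matrixP (R : comPzRingType) :
  Delta_SL R <-> forall n, (0 < n)%N -> forall k (G : 'M[R]_(k, n)), Delta_matrix G.
Proof.
split=> [DR n n_gt0 k G|DR M [p [k [m [P [mG mP]]]]]].
  have eG := cokernel_presents G.
  have [|fg /(_ n n_gt0)] := DR (cokernel G).
    by exists n, k, (cokernel_basis G), G.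
  move=> DG; apply: (Delta_SL_at_matrix eG); apply: DG.
  by apply/mu_leqP => //; exists (cokernel_basis G); exact: eG.1.
have fg : finitely_generated M by exists p, m.
split=> // n n_gt0 /(mu_leqP _ fg) gn; apply: matrix_Delta_SL_at => // u uG.
have [l [H uH]] := @presents_gen_tuple _ _ _ _ m P (conj mG mP) _ u uG.
by exists l, H; split=> //; exact: DR.
Qed.

Theorem proposition1p3 :
  (forall (X : Type) (R : X -> comPzRingType),
     (forall x, Delta_SL (R x)) -> Delta_SL (prod_ring R)) /\
  (forall (R Rbar : comPzRingType) (pi : {rmorphism R -> Rbar}),
     Delta_SL R ->
     set_surj [set: R] [set: Rbar] pi ->
     (forall n : nat, set_surj (SL n R) (SL n Rbar) (map_mx pi)) ->
     Delta_SL Rbar).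
Proof.
split=> [X R DR|R Rbar pi /Delta_SL_matrixP DR pi_surj _].
  apply/Delta_SL_matrixP => n n_gt0 k G; apply: Delta_matrix_prod => x.
  by have /Delta_SL_matrixP := DR x; exact.
apply/Delta_SL_matrixP => n n_gt0; apply: (Delta_matrix_quotient (f := pi)) => //.
  by move=> b; have [a _ <-] := pi_surj b I; exists a.
by move=> k G; exact: DR.
Qed.
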